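(* Let $0<c<1$. For real numbers $\alpha,\beta,\gamma,\zeta,\xi$ let $\boldsymbol{p}$ be the quartic triangular patch described in the context. If $\boldsymbol{p}$ is $G^1$-admissible (in the sense of the context), then $(\alpha,\beta,\zeta,\xi)$ is given in terms of $\gamma$ by one of the following two sets of formulas: (first set) $$\alpha=\frac{(6c^2-4)\gamma+c^2+2}{4c^2},\quad \beta=\frac{2\gamma-1}{2c^2},\quad \zeta=\frac{-4(9c^4-18c^2+8)\gamma+9c^6-24c^4-4c^2+16}{12c^2(3c^4-7c^2+4)},\quad \xi=\frac{-2(3c^4-3c^2-2)\gamma-c^2-2}{12c^2(1-c^2)};$$ (second set) $$\alpha=\frac{(9c^4-18c^2+8)\gamma-3c^4+10c^2-4}{c^2(4-3c^2)},\quad \beta=\frac{(6c^2-8)\gamma+4}{c^2(4-3c^2)},$$ $$\zeta=\frac{(9c^4-18c^2+8)\gamma-3c^4+10c^2-4}{6c^2(1-c^2)},\quad \xi=\frac{(9c^6-30c^4+36c^2-16)\gamma+3c^4-8c^2+8}{6c^2(3c^4-7c^2+4)}.$$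
   Context: $\Delta=\{(u,v)\in\mathbb{R}^2:\ 0\le u,v\le 1,\ v\le 1-u\}$. For $0<c<1$ let $\boldsymbol{v}_0=(c,0,\sqrt{1-c^2})^T$, $\boldsymbol{v}_1=(-\tfrac12c,\tfrac{\sqrt3}{2}c,\sqrt{1-c^2})^T$, $\boldsymbol{v}_2=(-\tfrac12c,-\tfrac{\sqrt3}{2}c,\sqrt{1-c^2})^T$ be the vertices of an equilateral spherical triangle on the unit sphere. The quartic patch is $\boldsymbol{p}:\Delta\to\mathbb{R}^3$, $\boldsymbol{p}(u,v)=\sum_{i+j+k=4}\frac{4!}{i!j!k!}u^iv^j(1-u-v)^k\,\boldsymbol{b}_{i,j,k}$ (with $i,j,k$ nonnegative integers), where $\boldsymbol{b}_{4,0,0}=\boldsymbol{v}_0$, $\boldsymbol{b}_{0,4,0}=\boldsymbol{v}_1$, $\boldsymbol{b}_{0,0,4}=\boldsymbol{v}_2$, $\boldsymbol{b}_{3,1,0}=\alpha\boldsymbol{v}_0+\beta\boldsymbol{v}_1$, $\boldsymbol{b}_{2,2,0}=\gamma(\boldsymbol{v}_0+\boldsymbol{v}_1)$, $\boldsymbol{b}_{2,1,1}=\zeta\boldsymbol{v}_0+\xi(\boldsymbol{v}_1+\boldsymbol{v}_2)$, and the remaining control points are obtained from these by symmetry, i.e. by applying the same permutation to the three index positions and to $(\boldsymbol{v}_0,\boldsymbol{v}_1,\boldsymbol{v}_2)$ (for instance $\boldsymbol{b}_{1,3,0}=\alpha\boldsymbol{v}_1+\beta\boldsymbol{v}_0$,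 $\boldsymbol{b}_{0,2,2}=\gamma(\boldsymbol{v}_1+\boldsymbol{v}_2)$, $\boldsymbol{b}_{1,2,1}=\zeta\boldsymbol{v}_1+\xi(\boldsymbol{v}_0+\boldsymbol{v}_2)$). The patch is called $G^1$-admissible if: (1) it is regular: $\partial_u\boldsymbol{p}$ and $\partial_v\boldsymbol{p}$ are linearly independent at every point of $\Delta$; (2) at each of the three vertices $\boldsymbol{v}_m$ of the patch, the normal of the tangent plane of the patch is parallel to $\boldsymbol{v}_m$; (3) at every point of each of the three boundary curves of the patch, the normal $\partial_u\boldsymbol{p}\times\partial_v\boldsymbol{p}$ lies in the plane through the origin and the two endpoints of that boundary curve. *)

(* Defs.v *)
From mathcomp Require Import all_boot all_order all_algebra.
From mathcomp Require Import all_classical all_reals all_analysis.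
Set Implicit Arguments.
Unset Strict Implicit.
Unset Printing Implicit Defensive.
Import Order.TTheory GRing.Theory Num.Theory.
Import numFieldNormedType.Exports.
Local Open Scope ring_scope.

Section Defs.
Context {R : realType}.
Implicit Types (c u v t : R) (a b : 'rV[R]_3) (p : R -> R -> 'rV[R]_3).

Definition vec3 (x y z : R) : 'rV[R]_3 := \row_(i < 3) [:: x; y; z]`_i.

Definition crossprod a b : 'rV[R]_3 :=
  vec3 (a 0 1 * b 0 2 - a 0 2 * b 0 1)
       (a 0 2 * b 0 0 - a 0 0 * b 0 2)
       (a 0 0 * b 0 1 - a 0 1 * b 0 0).

Definition vertex0 c := vec3 c 0 (Num.sqrt (1 - c ^+ 2)).
Definition vertex1 c :=
  vec3 (- (1 / 2) * c) (Num.sqrt 3 / 2 * c) (Num.sqrt (1 - c ^+ 2)).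
Definition vertex2 c :=
  vec3 (- (1 / 2) * c) (- (Num.sqrt 3 / 2) * c) (Num.sqrt (1 - c ^+ 2)).

(* The value outside i + j + k = 4 is irrelevant. *)
Definition control_point (v0 v1 v2 : 'rV[R]_3) (alpha beta gamma zeta xi : R)
    (i j k : nat) : 'rV[R]_3 :=
  match i, j, k with
  | 4%N, 0%N, 0%N => v0
  | 0%N, 4%N, 0%N => v1
  | 0%N, 0%N, 4%N => v2
  | 3%N, 1%N, 0%N => alpha *: v0 + beta *: v1
  | 3%N, 0%N, 1%N => alpha *: v0 + beta *: v2
  | 1%N, 3%N, 0%N => alpha *: v1 + beta *: v0
  | 0%N, 3%N, 1%N => alpha *: v1 + beta *: v2
  | 1%N, 0%N, 3%N => alpha *: v2 + beta *: v0
  | 0%N, 1%N, 3%N => alpha *: v2 + beta *: v1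
  | 2%N, 2%N, 0%N => gamma *: (v0 + v1)
  | 2%N, 0%N, 2%N => gamma *: (v0 + v2)
  | 0%N, 2%N, 2%N => gamma *: (v1 + v2)
  | 2%N, 1%N, 1%N => zeta *: v0 + xi *: (v1 + v2)
  | 1%N, 2%N, 1%N => zeta *: v1 + xi *: (v0 + v2)
  | 1%N, 1%N, 2%N => zeta *: v2 + xi *: (v0 + v1)
  | _, _, _ => 0
  end.

(* The defining polynomial is evaluated on all of R^2, so that both partial
   derivatives make sense on the boundary and at the corners of the domain
   triangle. *)
Definition quartic_patch (b : nat -> nat -> nat -> 'rV[R]_3) u v : 'rV[R]_3 :=
  \sum_(i < 5) \sum_(j < 5) \sum_(k < 5 | (i + j + k == 4)%N)
    ((4`!)%:R / (i`! * j`! * k`!)%:R * u ^+ i * v ^+ j * (1 - u - v) ^+ k)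
      *: b i j k.

Definition spherical_patch c (alpha beta gamma zeta xi : R) : R -> R -> 'rV[R]_3 :=
  quartic_patch (control_point (vertex0 c) (vertex1 c) (vertex2 c)
                   alpha beta gamma zeta xi).

Definition in_Delta u v : bool :=
  [&& 0 <= u <= 1, 0 <= v <= 1 & v <= 1 - u].

Definition partial_u p u v : 'rV[R]_3 := (fun x => p x v)^`()%classic u.
Definition partial_v p u v : 'rV[R]_3 := (fun y => p u y)^`()%classic v.

Definition patch_normal p u v : 'rV[R]_3 :=
  crossprod (partial_u p u v) (partial_v p u v).

Definition regular_patch p : Prop :=
  forall u v, in_Delta u v -> free [:: partial_u p u v; partial_v p u v].

(* The corners (1,0), (0,1), (0,0) of the domain are mapped to v0, v1, v2. *)
Definition G1_at_vertices (v0 v1 v2 : 'rV[R]_3) p : Prop :=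
  [/\ patch_normal p 1 0 \in <[v0]>%VS,
      patch_normal p 0 1 \in <[v1]>%VS
    & patch_normal p 0 0 \in <[v2]>%VS].

Definition G1_along_boundary (v0 v1 v2 : 'rV[R]_3) p : Prop :=
  forall t, 0 <= t <= 1 ->
  [/\ patch_normal p (1 - t) t \in <<[:: v0; v1]>>%VS,
      patch_normal p 0 t \in <<[:: v1; v2]>>%VS
    & patch_normal p t 0 \in <<[:: v0; v2]>>%VS].

Definition G1_admissible (v0 v1 v2 : 'rV[R]_3) p : Prop :=
  [/\ regular_patch p, G1_at_vertices v0 v1 v2 p
    & G1_along_boundary v0 v1 v2 p].

End Defs.

(* Main.v *)
(** Write m for the common inner product of the vertices, m = 1 - 3c^2/2.
  Orthogonality of the tangent plane to the vertex gives alpha = 1 - m beta.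
  Along an edge, the normal lies in the plane of the endpoints v0, v2 iff
  (p_u x p_v) . (v0 x v2) = 0; by Binet-Cauchy the left-hand side is a symmetric
  polynomial of degree 6 in the edge parameter t, and it is divisible by t(1 - t)
  once the vertex condition holds. Its three remaining coefficients are linear in
  zeta and xi. Eliminating these two unknowns leaves a product of three factors
  linear in beta and gamma: two of them define the two families, and the third
  one, like beta itself, cannot vanish because the edge curve would have zero
  velocity at its midpoint (respectively, at its endpoints). *)

Require Import Defs.
From mathcomp Require Import all_boot all_order all_algebra.
From mathcomp Require Import all_classical all_reals all_analysis.
From mathcomp Require Import ring lra.
Set Implicit Arguments.
Unset Strict Implicit.
Unset Printing Implicit Defensive.
Import Order.TTheory GRing.Theory Num.Theory.
Import numFieldNormedType.Exports.
Local Open Scope ring_scope.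

(** * Inner and cross products in three-space *)

Section DotProduct.
Context {R : realType}.
Implicit Types (k : R) (a b : 'rV[R]_3).

Definition dot3 a b : R := a 0 0 * b 0 0 + a 0 1 * b 0 1 + a 0 2 * b 0 2.

Lemma dot3C a b : dot3 a b = dot3 b a.
Proof. by rewrite /dot3; ring. Qed.

Lemma dot3Dl a a' b : dot3 (a + a') b = dot3 a b + dot3 a' b.
Proof. by rewrite /dot3 !mxE; ring. Qed.

Lemma dot3Zl k a b : dot3 (k *: a) b = k * dot3 a b.
Proof. by rewrite /dot3 !mxE; ring. Qed.

Lemma vec3E x y z :
  ((vec3 x y z : 'rV[R]_3) 0 0 = x) * ((vec3 x y z : 'rV[R]_3) 0 1 = y)
  * ((vec3 x y z : 'rV[R]_3) 0 2 = z).
Proof. by rewrite !mxE. Qed.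

(** The Binet-Cauchy identity. Through it the edge condition depends only on inner products of the
    vertices, so the square roots in their coordinates never enter. *)
Lemma dot3_crossprod a b a' b' :
  dot3 (crossprod a b) (crossprod a' b')
  = dot3 a a' * dot3 b b' - dot3 a b' * dot3 b a'.
Proof. by rewrite /crossprod /dot3 !vec3E; ring. Qed.

Lemma dot3_crossprodl a b : dot3 (crossprod a b) a = 0.
Proof. by rewrite /crossprod /dot3 !vec3E; ring. Qed.

Lemma dot3_crossprodr a b : dot3 (crossprod a b) b = 0.
Proof. by rewrite /crossprod /dot3 !vec3E; ring. Qed.

(** Turns the boundary condition into one scalar equation at each point of an edge. *)
Lemma span2_dot3_crossprod n a b :
  n \in <<[:: a; b]>>%VS -> dot3 n (crossprod a b) = 0.
Proof.
rewrite span_cons span_seq1 => /memv_addP[_ /vlineP[k ->] [_ /vlineP[l ->] ->]].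
by rewrite dot3Dl !dot3Zl !(dot3C _ (crossprod _ _)) dot3_crossprodl
  dot3_crossprodr !mulr0 addr0.
Qed.

Lemma ord3P (P : 'I_3 -> Prop) : P 0 -> P 1 -> P 2 -> forall i, P i.
Proof.
move=> P0 P1 P2 i.
have: i \in [:: 0; 1; 2] by case: i => -[|[|[|]]].
by rewrite !inE => /or3P[] /eqP->.
Qed.

Lemma row3P a b : a 0 0 = b 0 0 -> a 0 1 = b 0 1 -> a 0 2 = b 0 2 -> a = b.
Proof. by move=> ? ? ?; apply/rowP; apply: ord3P. Qed.

Lemma free_crossprod_neq0 a b : free [:: a; b] -> crossprod a b != 0.
Proof.
move=> fab; apply/eqP => /rowP n0.
have := (n0 0, n0 1, n0 2); rewrite /crossprod !vec3E !mxE => -[[n00 n01] n02].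
have /freeP f : free [tuple a; b] by [].
(* The entries of [- b 0 i *: a + a 0 i *: b] are, up to sign, entries of the cross product or zero;
   freeness then kills the second coefficient, [a 0 i]. *)
have coef0 i : a 0 i = 0.
  have := f (fun j => [:: - b 0 i; a 0 i]`_j).
  rewrite big_ord_recl big_ord1 /= => /(_ _ ord_max) /=; apply.
  by apply: row3P; rewrite !mxE; move: i; apply: ord3P; lra.
by have /negP := free_not0 fab (mem_head _ _); apply; apply/eqP/row3P;
  rewrite coef0 mxE.
Qed.

End DotProduct.

(** * Analytic derivatives reduced to formal derivatives of polynomials *)

Section Derivatives.
Context {R : realType}.

Lemma is_derive_hornerZ (V : normedModType R) (P : {poly R}) (a : V) (x : R) :
  is_derive x 1 (fun t => P.[t] *: a) (P^`().[x] *: a).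
Proof.
have dP : differentiable (horner P) x.
  by apply/derivable1_diffP; exact: derivable_horner.
apply: DeriveDef; first by apply/diff_derivable/differentiableZl.
rewrite deriveE; last exact: differentiableZl.
by rewrite diffZl // -deriveE // derive_val.
Qed.

Lemma derive1_hornerZ3 (V : normedModType R) (P Q S : {poly R}) (a b d : V) (x : R) :
  (fun t => P.[t] *: a + Q.[t] *: b + S.[t] *: d)^`()%classic x
  = P^`().[x] *: a + Q^`().[x] *: b + S^`().[x] *: d.
Proof.
have dP := is_derive_hornerZ P a x.
have dQ := is_derive_hornerZ Q b x.
have dS := is_derive_hornerZ S d x.
by rewrite derive1E; apply: derive_val.
Qed.

End Derivatives.

(** * The patch and its partial derivatives in terms of the three vertices *)

Section Coordinates.
Context {R : realType}.
Variables (alpha beta gamma zeta xi : R).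

(* The coefficient of one vertex in the patch, in terms of the barycentric
   coordinate [a] of that vertex and the two others. The embedding [f] of the
   scalars is [idfun] for values and [polyC] when differentiating formally. *)
Definition quartic_coord (S : comPzRingType) (f : R -> S) (a x y : S) : S :=
  a ^+ 4 + f (4 * alpha) * a ^+ 3 * (x + y) + f (6 * gamma) * a ^+ 2 * (x ^+ 2 + y ^+ 2)
  + f (12 * zeta) * a ^+ 2 * x * y + f (12 * xi) * a * (x ^+ 2 * y + x * y ^+ 2)
  + f (4 * beta) * a * (x ^+ 3 + y ^+ 3).

(** The formal partial derivative of [quartic_coord] in [a]; [dquartic_coord1] is the one in [x]. By
    symmetry in [x] and [y], the one in [y] is [dquartic_coord1] with these two arguments
    exchanged. *)
Definition dquartic_coord0 (S : comPzRingType) (f : R -> S) (a x y : S) : S :=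
  f 4 * a ^+ 3 + f (12 * alpha) * a ^+ 2 * (x + y)
  + f (12 * gamma) * a * (x ^+ 2 + y ^+ 2) + f (24 * zeta) * a * x * y
  + f (12 * xi) * (x ^+ 2 * y + x * y ^+ 2) + f (4 * beta) * (x ^+ 3 + y ^+ 3).

Definition dquartic_coord1 (S : comPzRingType) (f : R -> S) (a x y : S) : S :=
  f (4 * alpha) * a ^+ 3 + f (12 * gamma) * a ^+ 2 * x
  + f (12 * zeta) * a ^+ 2 * y + f (12 * xi) * a * (2 * x * y + y ^+ 2)
  + f (12 * beta) * a * x ^+ 2.

Lemma deriv_quartic_coord (a x y : {poly R}) :
  (quartic_coord polyC a x y)^`() =
  dquartic_coord0 polyC a x y * a^`() + dquartic_coord1 polyC a x y * x^`()
  + dquartic_coord1 polyC a y x * y^`().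
Proof.
rewrite /quartic_coord /dquartic_coord0 /dquartic_coord1.
rewrite !polyCM.
rewrite !(derivD, derivM, deriv_exp, derivC) -?polyCM.
ring.
Qed.

Lemma horner_quartic_coord (a x y : {poly R}) t :
  (quartic_coord polyC a x y).[t] = quartic_coord idfun a.[t] x.[t] y.[t].
Proof. by rewrite /quartic_coord !hornerE. Qed.

Lemma horner_dquartic_coord0 (a x y : {poly R}) t :
  (dquartic_coord0 polyC a x y).[t] = dquartic_coord0 idfun a.[t] x.[t] y.[t].
Proof. by rewrite /dquartic_coord0 !hornerE. Qed.

Lemma horner_dquartic_coord1 (a x y : {poly R}) t :
  (dquartic_coord1 polyC a x y).[t] = dquartic_coord1 idfun a.[t] x.[t] y.[t].
Proof. by rewrite /dquartic_coord1 !hornerE. Qed.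

Variables v0 v1 v2 : 'rV[R]_3.

Let p := quartic_patch (control_point v0 v1 v2 alpha beta gamma zeta xi).

Lemma quartic_patchE u v : p u v =
  quartic_coord idfun u v (1 - u - v) *: v0
  + quartic_coord idfun v u (1 - u - v) *: v1
  + quartic_coord idfun (1 - u - v) u v *: v2.
Proof.
rewrite /p /quartic_patch /quartic_coord /=; set w := 1 - u - v.
have sum5 (F : 'I_5 -> 'rV[R]_3) :
    \sum_i F i = F (@Ordinal 5 0 isT) + F (@Ordinal 5 1 isT)
      + F (@Ordinal 5 2 isT) + F (@Ordinal 5 3 isT) + F (@Ordinal 5 4 isT).
  rewrite !big_ord_recr big_ord0 /= add0r.
  by congr (F _ + F _ + F _ + F _ + F _); exact: val_inj.
(* The constraint on the indices becomes a conditional, so that all 125 terms can be evaluated by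
   computation. *)
under eq_bigr do under eq_bigr do rewrite big_mkcond sum5.
under eq_bigr do rewrite sum5.
rewrite sum5 /= !factS fact0.
apply/rowP => i; rewrite !mxE.
by field.
Qed.

Lemma partial_u_quartic_patch u v : partial_u p u v =
  (dquartic_coord0 idfun u v (1 - u - v) - dquartic_coord1 idfun u (1 - u - v) v) *: v0
  + (dquartic_coord1 idfun v u (1 - u - v) - dquartic_coord1 idfun v (1 - u - v) u) *: v1
  + (dquartic_coord1 idfun (1 - u - v) u v - dquartic_coord0 idfun (1 - u - v) u v) *: v2.
Proof.
(* The third barycentric coordinate along a line of constant [v]; its derivative -1 produces the
   subtracted terms. *)
pose W : {poly R} := 1 - 'X - v%:P.
have -> : partial_u p u v = (fun t => (quartic_coord polyC 'X v%:P W).[t] *: v0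
    + (quartic_coord polyC v%:P 'X W).[t] *: v1
    + (quartic_coord polyC W 'X v%:P).[t] *: v2)^`()%classic u.
  rewrite /partial_u; congr (_^`()%classic u); apply/funext => t.
  rewrite quartic_patchE !horner_quartic_coord.
  by rewrite !(hornerD, hornerN, hornerC, hornerX).
rewrite derive1_hornerZ3 !deriv_quartic_coord /W.
rewrite !hornerD !hornerM !horner_dquartic_coord0 !horner_dquartic_coord1.
rewrite !(derivB, derivC, derivX).
rewrite !(hornerD, hornerN, hornerC, hornerX).
by congr (_ *: _ + _ *: _ + _ *: _); ring.
Qed.

Lemma partial_v_quartic_patch u v : partial_v p u v =
  (dquartic_coord1 idfun u v (1 - u - v) - dquartic_coord1 idfun u (1 - u - v) v) *: v0
  + (dquartic_coord0 idfun v u (1 - u - v) - dquartic_coord1 idfun v (1 - u - v) u) *: v1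
  + (dquartic_coord1 idfun (1 - u - v) v u - dquartic_coord0 idfun (1 - u - v) u v) *: v2.
Proof.
pose W : {poly R} := 1 - u%:P - 'X.
have -> : partial_v p u v = (fun t => (quartic_coord polyC u%:P 'X W).[t] *: v0
    + (quartic_coord polyC 'X u%:P W).[t] *: v1
    + (quartic_coord polyC W u%:P 'X).[t] *: v2)^`()%classic v.
  rewrite /partial_v; congr (_^`()%classic v); apply/funext => t.
  rewrite quartic_patchE !horner_quartic_coord.
  by rewrite !(hornerD, hornerN, hornerC, hornerX).
rewrite derive1_hornerZ3 !deriv_quartic_coord /W.
rewrite !hornerD !hornerM !horner_dquartic_coord0 !horner_dquartic_coord1.
rewrite !(derivB, derivC, derivX).
rewrite !(hornerD, hornerN, hornerC, hornerX).
by congr (_ *: _ + _ *: _ + _ *: _); ring.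
Qed.

End Coordinates.

(** * Algebra of the edge conditions *)

Section EdgeConditions.
Variables (R : realFieldType) (m beta gamma zeta xi : R).
Let alpha : R := 1 - m * beta.

(* Coefficients of s^5 t, s^4 t^2 and s^3 t^3 (s = 1 - t) in the edge
   polynomial; see [dot3_normal_edge]. *)
Definition edge_coef1 : R :=
  3 * beta * ((1 + m) * (alpha - zeta + m * gamma - 2 * m * xi)
              - m * (alpha - beta)).

Definition edge_coef2 : R :=
  (1 + m) * (3 * m * beta * (gamma - zeta) + 9 * (alpha - gamma) * (beta - xi)
             + 3 * beta * (gamma - xi) + 9 * (gamma - beta) * (alpha - zeta)
             + 3 * m * beta * (alpha - gamma))
  - m * (3 * beta * (alpha - beta) + 9 * xi * (alpha - beta)
         + 3 * (1 + m) * xi * beta).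

Definition edge_coef3 : R :=
  (1 + m) * (9 * (alpha - gamma) * (gamma - zeta)
             + 9 * (gamma - beta) * (beta - xi) + beta ^+ 2
             + 9 * (gamma - beta) * (gamma - xi)
             + 9 * (alpha - gamma) * (alpha - zeta) + m ^+ 2 * beta ^+ 2)
  - m * (2 * (1 + m) * beta ^+ 2 + 18 * xi * (alpha - beta)).

(** Since [alpha + m * beta = 1], the second factor of [edge_coef1] equals [1 + (1 + m) * (m * gamma
    - 2 * m * xi - zeta)]. *)
Lemma edge_coef1_eq0 : 1 + m != 0 -> beta != 0 -> edge_coef1 = 0 ->
  zeta = 1 / (1 + m) + m * gamma - 2 * m * xi.
Proof.
move=> m1 beta0 /eqP; rewrite !mulf_eq0 (negPf beta0) pnatr_eq0 /= => /eqP E.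
have -> : zeta = 1 / (1 + m) + m * gamma - 2 * m * xi
    - ((1 + m) * (alpha - zeta + m * gamma - 2 * m * xi)
       - m * (alpha - beta)) / (1 + m) by rewrite /alpha; field.
by rewrite E mul0r subr0.
Qed.

(* Eliminating [xi] between the two remaining conditions, which are linear in
   it; the last factor vanishes iff the edge curve is singular at its midpoint. *)
Lemma edge_coef_resultant : 1 + m != 0 -> 1 - m != 0 -> 1 + 2 * m != 0 ->
  zeta = 1 / (1 + m) + m * gamma - 2 * m * xi ->
  edge_coef2 = 0 -> edge_coef3 = 0 ->
  (4 * (1 - m) * beta - 3 * (2 * gamma - 1))
  * ((1 - m) * (1 + m) * beta - 3 * (1 - (1 + m) * gamma))
  * (2 * (1 + m) * beta - 3) = 0.
Proof.
move=> m1 m2 m3 zetaE E2 E3; apply: (@mulfI _ (- 3 * (1 - m) * (1 + 2 * m))).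
  by rewrite !mulf_neq0 // oppr_eq0 pnatr_eq0.
rewrite mulr0.
(* Once [zeta] is substituted, the two multipliers are the coefficients of [xi] in [edge_coef3] and
   in [edge_coef2], so [xi] cancels. *)
transitivity (18 * (1 + 2 * m) * ((1 + m) * (1 - m) * beta - (1 + m) * gamma + m)
    * edge_coef2
  - 3 * (1 + 2 * m) * (- (1 - m) * (1 + m) * beta + 3 * (1 + m) * gamma - 3)
    * edge_coef3); last by rewrite E2 E3 !mulr0 subr0.
by rewrite /edge_coef2 /edge_coef3 zetaE /alpha; field.
Qed.

End EdgeConditions.

Lemma edge_coef_solve (R : realFieldType) (c m alpha beta gamma zeta xi : R) :
  0 < c < 1 -> m = 1 - 3 / 2 * c ^+ 2 -> alpha = 1 - m * beta ->
  beta != 0 -> 2 * (1 + m) * beta != 3 ->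
  edge_coef1 m beta gamma zeta xi = 0 -> edge_coef2 m beta gamma zeta xi = 0 ->
  edge_coef3 m beta gamma zeta xi = 0 ->
  [/\ alpha = ((6 * c ^+ 2 - 4) * gamma + c ^+ 2 + 2) / (4 * c ^+ 2),
      beta = (2 * gamma - 1) / (2 * c ^+ 2),
      zeta = (- 4 * (9 * c ^+ 4 - 18 * c ^+ 2 + 8) * gamma
              + 9 * c ^+ 6 - 24 * c ^+ 4 - 4 * c ^+ 2 + 16)
             / (12 * c ^+ 2 * (3 * c ^+ 4 - 7 * c ^+ 2 + 4))
    & xi = (- 2 * (3 * c ^+ 4 - 3 * c ^+ 2 - 2) * gamma - c ^+ 2 - 2)
           / (12 * c ^+ 2 * (1 - c ^+ 2))]
  \/
  [/\ alpha = ((9 * c ^+ 4 - 18 * c ^+ 2 + 8) * gamma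
               - 3 * c ^+ 4 + 10 * c ^+ 2 - 4)
              / (c ^+ 2 * (4 - 3 * c ^+ 2)),
      beta = ((6 * c ^+ 2 - 8) * gamma + 4) / (c ^+ 2 * (4 - 3 * c ^+ 2)),
      zeta = ((9 * c ^+ 4 - 18 * c ^+ 2 + 8) * gamma
              - 3 * c ^+ 4 + 10 * c ^+ 2 - 4)
             / (6 * c ^+ 2 * (1 - c ^+ 2))
    & xi = ((9 * c ^+ 6 - 30 * c ^+ 4 + 36 * c ^+ 2 - 16) * gamma
            + 3 * c ^+ 4 - 8 * c ^+ 2 + 8)
           / (6 * c ^+ 2 * (3 * c ^+ 4 - 7 * c ^+ 2 + 4))].
Proof.
move=> /andP[c_gt0 c_lt1] mE alphaE beta0 mid E1 E2 E3.
have c2 : c ^+ 2 < 1 by rewrite expr_lt1 // ltW.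
have c0 : c != 0 by rewrite gt_eqF.
have d1 : 1 - c ^+ 2 != 0 by apply: lt0r_neq0; lra.
have d2 : 4 - 3 * c ^+ 2 != 0 by apply: lt0r_neq0; lra.
have d3 : 3 * c ^+ 4 - 7 * c ^+ 2 + 4 != 0.
  have -> : 3 * c ^+ 4 - 7 * c ^+ 2 + 4 = (1 - c ^+ 2) * (4 - 3 * c ^+ 2) by ring.
  by rewrite mulf_neq0.
have m1E : 1 + m = (4 - 3 * c ^+ 2) / 2 by rewrite mE; field.
have m2E : 1 - m = 3 / 2 * c ^+ 2 by rewrite mE; ring.
have m3E : 1 + 2 * m = 3 * (1 - c ^+ 2) by rewrite mE; field.
have m1 : 1 + m != 0 by rewrite m1E mulf_neq0 ?invr_eq0 ?pnatr_eq0.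
have m2 : 1 - m != 0 by rewrite m2E !mulf_neq0 ?invr_eq0 ?pnatr_eq0 ?expf_neq0.
have m3 : 1 + 2 * m != 0 by rewrite m3E mulf_neq0 ?pnatr_eq0.
have zetaE := edge_coef1_eq0 m1 beta0 E1.
have /eqP := edge_coef_resultant m1 m2 m3 zetaE E2 E3.
rewrite mulf_eq0 [_ - 3 == 0]subr_eq0 (negPf mid) orbF mulf_eq0.
case/orP => /eqP L; [left | right].
  have betaE : beta = (2 * gamma - 1) / (2 * c ^+ 2).
    have -> : beta = (2 * gamma - 1) / (2 * c ^+ 2)
      + (4 * (1 - m) * beta - 3 * (2 * gamma - 1)) / (6 * c ^+ 2).
      by rewrite m2E; field; rewrite c0.
    by rewrite L mul0r addr0.
  (* In the first family this quantity is, up to the factor [27 * (1 - c ^+ 2) / 8], the coefficient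
     of [xi] in [edge_coef2]; it is also a nonzero multiple of the midpoint factor. *)
  have X : (4 - 3 * c ^+ 2) * (2 * gamma + 1) - 8 != 0.
    apply: contra_neq mid => X; apply/eqP; rewrite -subr_eq0.
    have -> : 2 * (1 + m) * beta - 3
      = ((4 - 3 * c ^+ 2) * (2 * gamma + 1) - 8) / (2 * c ^+ 2).
      by rewrite m1E betaE; field; rewrite c0.
    by rewrite X mul0r.
  have xiE : xi = (- 2 * (3 * c ^+ 4 - 3 * c ^+ 2 - 2) * gamma - c ^+ 2 - 2)
           / (12 * c ^+ 2 * (1 - c ^+ 2)).
    apply: subr0_eq; apply: (mulfI X); rewrite mulr0.
    transitivity (edge_coef2 m beta gamma zeta xi * 8 / (27 * (1 - c ^+ 2)));
      last by rewrite E2 !mul0r.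
    rewrite /edge_coef2 zetaE m1E mE betaE; field.
    by rewrite d1 d2 c0.
  split=> //.
  - by rewrite alphaE mE betaE; field; rewrite c0.
  - by rewrite zetaE m1E mE xiE; field; rewrite d1 d2 d3 c0.
have betaE : beta = ((6 * c ^+ 2 - 8) * gamma + 4) / (c ^+ 2 * (4 - 3 * c ^+ 2)).
  have -> : beta = ((6 * c ^+ 2 - 8) * gamma + 4) / (c ^+ 2 * (4 - 3 * c ^+ 2))
    + ((1 - m) * (1 + m) * beta - 3 * (1 - (1 + m) * gamma))
      * 4 / (3 * c ^+ 2 * (4 - 3 * c ^+ 2)).
    by rewrite m1E m2E; field; rewrite d2 c0.
  by rewrite L !mul0r addr0.
have xiE : xi = ((9 * c ^+ 6 - 30 * c ^+ 4 + 36 * c ^+ 2 - 16) * gamma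
            + 3 * c ^+ 4 - 8 * c ^+ 2 + 8)
           / (6 * c ^+ 2 * (3 * c ^+ 4 - 7 * c ^+ 2 + 4)).
  (* In the second family the coefficient of [xi] in [edge_coef2] is a nonzero multiple of
     [beta]. *)
  apply: subr0_eq; apply: (mulfI beta0); rewrite mulr0.
  transitivity (- edge_coef2 m beta gamma zeta xi * 2
    / (27 * c ^+ 2 * (1 - c ^+ 2) * (4 - 3 * c ^+ 2)));
    last by rewrite E2 oppr0 !mul0r.
  rewrite /edge_coef2 zetaE m1E mE betaE; field.
  by rewrite d1 d2 d3 c0.
split=> //.
- by rewrite alphaE mE betaE; field; rewrite d2 c0.
- by rewrite zetaE m1E mE xiE; field; rewrite d1 d2 d3 c0.
Qed.

(** The values at 1/2, 1/3 and 1/4, with denominators cleared, form an invertible linear system in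
    the three coefficients. *)
Lemma symmetric_quartic_eq0 (R : realFieldType) (a b d : R) :
  (forall t, 0 < t < 1 ->
    a * (t ^+ 4 + (1 - t) ^+ 4) + b * (t ^+ 3 * (1 - t) + t * (1 - t) ^+ 3)
    + d * (t ^+ 2 * (1 - t) ^+ 2) = 0) -> [/\ a = 0, b = 0 & d = 0].
Proof.
move=> q0; have h2 := q0 (1 / 2); have h3 := q0 (1 / 3); have h4 := q0 (1 / 4).
have {}h2 : 2 * a + 2 * b + d = 0.
  by rewrite -[RHS](mulr0 16) -[X in 16 * X]h2; [field | lra].
have {}h3 : 17 * a + 10 * b + 4 * d = 0.
  by rewrite -[RHS](mulr0 81) -[X in 81 * X]h3; [field | lra].
have {}h4 : 82 * a + 30 * b + 9 * d = 0.
  by rewrite -[RHS](mulr0 256) -[X in 256 * X]h4; [field | lra].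
by split; lra.
Qed.

(** * Inner products of the vertices of the spherical triangle *)

Section Vertices.
Variables (R : realType) (c : R).
Hypothesis c01 : 0 < c < 1.

Let sqr_sqrt1Bc2 : Num.sqrt (1 - c ^+ 2) ^+ 2 = 1 - c ^+ 2.
Proof.
case/andP: c01 => c0 c1; rewrite sqr_sqrtr // subr_ge0 ltW //.
by rewrite expr_lt1 // ltW.
Qed.

Let sqr_sqrt3 : Num.sqrt (3 : R) ^+ 2 = 3.
Proof. by rewrite sqr_sqrtr. Qed.

Lemma dot3_vertex00 : dot3 (vertex0 c) (vertex0 c) = 1.
Proof. by rewrite /dot3 !vec3E mul0r addr0 -!expr2 sqr_sqrt1Bc2; ring. Qed.

Lemma dot3_vertex22 : dot3 (vertex2 c) (vertex2 c) = 1.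
Proof.
rewrite /dot3 !vec3E -!expr2 sqr_sqrt1Bc2 !(exprMn, sqrrN) sqr_sqrt3.
by field.
Qed.

Lemma dot3_vertex01 : dot3 (vertex0 c) (vertex1 c) = 1 - 3 / 2 * c ^+ 2.
Proof. by rewrite /dot3 !vec3E mul0r addr0 -expr2 sqr_sqrt1Bc2; field. Qed.

Lemma dot3_vertex02 : dot3 (vertex0 c) (vertex2 c) = 1 - 3 / 2 * c ^+ 2.
Proof. by rewrite /dot3 !vec3E mul0r addr0 -expr2 sqr_sqrt1Bc2; field. Qed.

Lemma dot3_vertex12 : dot3 (vertex1 c) (vertex2 c) = 1 - 3 / 2 * c ^+ 2.
Proof.
rewrite /dot3 !vec3E -!expr2 sqr_sqrt1Bc2.
have -> : Num.sqrt 3 / 2 * c * (- (Num.sqrt 3 / 2) * c) = - (3 / 4) * c ^+ 2.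
  by rewrite -[X in - (X / 4)]sqr_sqrt3; field.
by field.
Qed.

End Vertices.

(** * Geometric conditions on the edge from [v2] to [v0] *)

Section Patch.
Variables (R : realType) (m alpha beta gamma zeta xi : R).
Variables v0 v1 v2 : 'rV[R]_3.
Hypotheses (v00 : dot3 v0 v0 = 1) (v22 : dot3 v2 v2 = 1).
Hypotheses (v01 : dot3 v0 v1 = m) (v02 : dot3 v0 v2 = m) (v12 : dot3 v1 v2 = m).
Let p := quartic_patch (control_point v0 v1 v2 alpha beta gamma zeta xi).

Lemma partial_u_corner : partial_u p 0 0 = (4 * beta) *: v0 + (4 * (alpha - 1)) *: v2.
Proof.
rewrite partial_u_quartic_patch.
rewrite [X in _ + X *: v1 + _](_ : _ = 0) ?scale0r ?addr0; last first.
  by rewrite /dquartic_coord1 /=; ring.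
by congr (_ *: _ + _ *: _); rewrite /dquartic_coord0 /dquartic_coord1 /=; ring.
Qed.

(** Identifies the third factor of the resultant with the speed of the edge curve at its midpoint,
    where regularity forbids it to vanish. *)
Lemma partial_u_midpoint : alpha = 1 - m * beta ->
  partial_u p (1 / 2) 0 = ((3 - 2 * (1 + m) * beta) / 2) *: (v0 - v2).
Proof.
move=> alphaE; rewrite partial_u_quartic_patch.
rewrite [X in _ + X *: v1 + _](_ : _ = 0) ?scale0r ?addr0; last first.
  by rewrite /dquartic_coord1 /=; field.
rewrite scalerBr -scaleNr.
by congr (_ *: _ + _ *: _);
  rewrite /dquartic_coord0 /dquartic_coord1 alphaE /=; field.
Qed.

(** On this edge the partial derivatives are A v0 + B v2 and C v0 + D v1 + E v2, and Binet-Cauchy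
    gives (1 - m) ((1 + m) (A E - B C) + m D (A - B)). This explains the factor [1 - m] and the
    shape of the edge coefficients. *)
Lemma dot3_normal_edge t : alpha = 1 - m * beta ->
  dot3 (patch_normal p t 0) (crossprod v0 v2)
  = - 16 * (1 - m) * t * (1 - t)
    * (edge_coef1 m beta gamma zeta xi * (t ^+ 4 + (1 - t) ^+ 4)
       + edge_coef2 m beta gamma zeta xi * (t ^+ 3 * (1 - t) + t * (1 - t) ^+ 3)
       + edge_coef3 m beta gamma zeta xi * (t ^+ 2 * (1 - t) ^+ 2)).
Proof.
move=> alphaE; rewrite /patch_normal dot3_crossprod.
rewrite partial_u_quartic_patch partial_v_quartic_patch !dot3Dl !dot3Zl.
rewrite (dot3C v1 v0) (dot3C v2 v0) v00 v01 v02 v12 v22.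
rewrite /dquartic_coord0 /dquartic_coord1 /edge_coef1 /edge_coef2 /edge_coef3 alphaE /=.
ring.
Qed.

(** By regularity the normal is a nonzero multiple of [v2], so [partial_u p 0 0] is orthogonal to
    [v2]; the inner product is [4 * (m * beta + alpha - 1)]. *)
Lemma corner_condition : free [:: partial_u p 0 0; partial_v p 0 0] ->
  patch_normal p 0 0 \in <[v2]>%VS -> alpha = 1 - m * beta.
Proof.
move=> fp /vlineP[k nE].
have := dot3_crossprodl (partial_u p 0 0) (partial_v p 0 0).
rewrite [crossprod _ _]nE dot3Zl => /eqP; rewrite mulf_eq0 => /orP[/eqP k0|].
  by have := free_crossprod_neq0 fp; rewrite [crossprod _ _]nE k0 scale0r eqxx.
rewrite partial_u_corner dot3C dot3Dl !dot3Zl v02 v22 => /eqP.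
by lra.
Qed.

End Patch.

(** * Assembly: from admissibility to the two families *)

Theorem mainTheorem4 (R : realType) (c : R) (c01 : 0 < c < 1)
    (alpha beta gamma zeta xi : R) :
  G1_admissible (vertex0 c) (vertex1 c) (vertex2 c)
    (spherical_patch c alpha beta gamma zeta xi) ->
  [/\ alpha = ((6 * c ^+ 2 - 4) * gamma + c ^+ 2 + 2) / (4 * c ^+ 2),
      beta = (2 * gamma - 1) / (2 * c ^+ 2),
      zeta = (- 4 * (9 * c ^+ 4 - 18 * c ^+ 2 + 8) * gamma
              + 9 * c ^+ 6 - 24 * c ^+ 4 - 4 * c ^+ 2 + 16)
             / (12 * c ^+ 2 * (3 * c ^+ 4 - 7 * c ^+ 2 + 4))
    & xi = (- 2 * (3 * c ^+ 4 - 3 * c ^+ 2 - 2) * gamma - c ^+ 2 - 2)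
           / (12 * c ^+ 2 * (1 - c ^+ 2))]
  \/
  [/\ alpha = ((9 * c ^+ 4 - 18 * c ^+ 2 + 8) * gamma
               - 3 * c ^+ 4 + 10 * c ^+ 2 - 4)
              / (c ^+ 2 * (4 - 3 * c ^+ 2)),
      beta = ((6 * c ^+ 2 - 8) * gamma + 4) / (c ^+ 2 * (4 - 3 * c ^+ 2)),
      zeta = ((9 * c ^+ 4 - 18 * c ^+ 2 + 8) * gamma
              - 3 * c ^+ 4 + 10 * c ^+ 2 - 4)
             / (6 * c ^+ 2 * (1 - c ^+ 2))
    & xi = ((9 * c ^+ 6 - 30 * c ^+ 4 + 36 * c ^+ 2 - 16) * gamma
            + 3 * c ^+ 4 - 8 * c ^+ 2 + 8)
           / (6 * c ^+ 2 * (3 * c ^+ 4 - 7 * c ^+ 2 + 4))].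
Proof.
case=> reg [_ _ corner] edge; rewrite /spherical_patch in reg corner edge.
have [v00 v22] := (dot3_vertex00 c01, dot3_vertex22 c01).
have v01 := dot3_vertex01 c01; have v02 := dot3_vertex02 c01.
have v12 := dot3_vertex12 c01.
set m := 1 - 3 / 2 * c ^+ 2 in v01 v02 v12.
have D00 : in_Delta (0 : R) 0 by rewrite /in_Delta; lra.
have Dmid : in_Delta (1 / 2 : R) 0 by rewrite /in_Delta; lra.
have alphaE := corner_condition v22 v02 (reg _ _ D00) corner.
(* With [beta = 0] the corner condition gives [alpha = 1], and [partial_u] vanishes at the
   corner. *)
have beta0 : beta != 0.
  apply: contraTneq (free_not0 (reg _ _ D00) (mem_head _ _)) => b0.
  by rewrite negbK partial_u_corner alphaE b0 !(mulr0, subr0, subrr, scale0r) addr0.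
have mid : 2 * (1 + m) * beta != 3.
  apply: contraTneq (free_not0 (reg _ _ Dmid) (mem_head _ _)) => b3.
  by rewrite negbK (partial_u_midpoint _ _ _ _ _ _ alphaE) b3 subrr mul0r scale0r.
have m1 : 1 - m != 0.
  by case/andP: c01 => c0 _; rewrite /m subKr mulf_neq0 ?expf_neq0 ?gt_eqF.
have [E1 E2 E3] : [/\ edge_coef1 m beta gamma zeta xi = 0,
    edge_coef2 m beta gamma zeta xi = 0 & edge_coef3 m beta gamma zeta xi = 0].
  (* Only interior points of the edge are sampled, so the factor [t * (1 - t)] can be cancelled. *)
  apply: symmetric_quartic_eq0 => t /andP[t0 t1].
  have [|_ _ /span2_dot3_crossprod] := edge t; first by rewrite !ltW.
  rewrite (dot3_normal_edge _ _ _ v00 v22 v01 v02 v12) // => /eqP.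
  rewrite mulf_eq0 => /orP[|/eqP //].
  by rewrite !mulf_eq0 oppr_eq0 pnatr_eq0 (negPf m1) subr_eq0 !gt_eqF.
exact: (edge_coef_solve c01 _ alphaE beta0 mid E1 E2 E3).
Qed.
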